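(* Let $K=[-1,1]^n$, let $\lambda$ be the Lebesgue measure on $K$, and let $N\ge1$. Let $f_1,\dots,f_N,g_1,\dots,g_N\in\mathbb{R}[x_1,\dots,x_n]$ with each $g_i$ taking only positive values on $K$, and let $\rho:=\min_{x\in K}\sum_{i=1}^N f_i(x)/g_i(x)$. For $d,s\in\mathbb{N}$ define $$\Delta_{d,s}:=\min_{\sigma_1,\dots,\sigma_N\in\Sigma[x]_d}\max\Big\{\max_{|\alpha|\le s,\ 2\le i\le N}\Big|\int_K x^\alpha g_i\sigma_i\,d\lambda-\int_K x^\alpha g_1\sigma_1\,d\lambda\Big|,\ \Big|\int_K g_1\sigma_1\,d\lambda-1\Big|,\ \Big|\sum_{i=1}^N\int_K f_i\sigma_i\,d\lambda-\rho\Big|\Big\}.$$ For $s,d\in\mathbb{N}$ and $\varepsilon>0$ let $\rho_s(\varepsilon)=\rho_{s,d}(\varepsilon)$ be the infimum of $\sum_{i=1}^N\int_K f_i\sigma_i\,d\lambda$ over all $\sigma_1,\dots,\sigma_N\in\Sigma[x]_d$ satisfying $$\Big|\int_K x^\alpha g_i\sigma_i\,d\lambda-\int_K x^\alpha g_1\sigma_1\,d\lambda\Big|\le\varepsilon\quad(|\alpha|\le s,\ 1<i\le N),\qquad \Big|\int_K g_1\sigma_1\,d\lambda-1\Big|\le\varepsilon .$$ Then there exists a sequence of positive integers $(d_0(s))_{s\in\mathbb{N}}$ such that $$\lim_{s\to\infty}\Delta_{d_0(s),s}=0\qquad\text{and}\qquad \lim_{s\to\infty}\rho_s\Big(\frac{1}{\sqrt{d_0(s)}}\Big)=\rho,$$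 where in the second limit $\rho_s(1/\sqrt{d_0(s)})$ is taken with any SOS degree parameter $d=d(s)\ge d_0(s)$; that is, $\lim_{s\to\infty}\rho_{s,d(s)}(1/\sqrt{d_0(s)})=\rho$ for every choice of integers $d(s)\ge d_0(s)$.
   Context: $\Sigma[x]_d$ is the set of polynomials in $x=(x_1,\dots,x_n)$ of total degree at most $2d$ that are finite sums of squares of real polynomials. For $\alpha\in\mathbb{N}^n$, $x^\alpha=x_1^{\alpha_1}\cdots x_n^{\alpha_n}$ and $|\alpha|=\sum_i\alpha_i$. When $N=1$ the maximum over $2\le i\le N$ and the corresponding constraints are absent. *)

(* Defs.v *)
From HB Require Import structures.
From mathcomp Require Import all_boot all_order all_algebra.
(* The notations of mpoly, and the name isMeasure, clash with MathComp-Analysis. *)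
From mathcomp Require Import -(notations) mpoly.
From mathcomp Require Import all_classical all_reals all_analysis.

Set Implicit Arguments.
Unset Strict Implicit.
Unset Printing Implicit Defensive.
Import Order.TTheory GRing.Theory Num.Theory.
Import numFieldNormedType.Exports.
Local Open Scope classical_set_scope.
Local Open Scope ring_scope.

Section lebesgue_tuple.
Context {R : realType}.
Local Notation T := (measurableTypeR R).

Definition tuple_cons n (p : T * n.-tuple T) : n.+1.-tuple T :=
  [tuple of p.1 :: p.2].

Lemma measurable_tuple_cons n : measurable_fun setT (@tuple_cons n).
Proof. exact: measurable_cons. Qed.

Section step.
Variables (n : nat) (m : {sigma_finite_measure set (n.-tuple T) -> \bar R}).

Definition lebesgue_cons : set (n.+1.-tuple T) -> \bar R :=
  pushforward (lebesgue_measure \x m)%E (@tuple_cons n).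

Let lebesgue_cons0 : lebesgue_cons set0 = 0%E.
Proof. by rewrite /lebesgue_cons /pushforward preimage_set0 measure0. Qed.

Let lebesgue_cons_ge0 A : (0 <= lebesgue_cons A)%E.
Proof. exact: (measure_ge0 (lebesgue_measure \x m)%E). Qed.

Let lebesgue_cons_sigma_additive : semi_sigma_additive lebesgue_cons.
Proof.
move=> F mF tF mUF; rewrite /lebesgue_cons /pushforward preimage_bigcup.
have mc := @measurable_tuple_cons n.
apply: measure_semi_sigma_additive.
- by move=> k; rewrite -[X in measurable X]setTI; exact: mc.
- apply/trivIsetP => /= i j _ _ ij; rewrite -preimage_setI.
  by move/trivIsetP : tF => /(_ _ _ _ _ ij) ->//; rewrite preimage_set0.
- by rewrite -preimage_bigcup -[X in measurable X]setTI; exact: mc.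
Qed.

HB.instance Definition _ := isMeasure.Build _ _ _ lebesgue_cons
  lebesgue_cons0 lebesgue_cons_ge0 lebesgue_cons_sigma_additive.

Let lebesgue_cons_sigma_finite : sigma_finite setT lebesgue_cons.
Proof.
have [F TF Foo] : sigma_finite setT (lebesgue_measure \x m)%E.
  have /sigma_finiteP[F [TF ndF Foo]] := sigma_finiteT (@lebesgue_measure R).
  have /sigma_finiteP[G [TG ndG Goo]] := sigma_finiteT m.
  exists (fun k => F k `*` G k).
    rewrite -setXTT TF TG; apply/seteqP; split=> -[x y].
      move=> [/= [k _ Fkx] [l _ Gly]]; exists (maxn k l) => //; split.
      - by move: x Fkx; exact/subsetPset/ndF/leq_maxl.
      - by move: y Gly; exact/subsetPset/ndG/leq_maxr.
    by move=> [k _ []/= ? ?]; split; exists k.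
  move=> k; have [? ?] := Foo k; have [? ?] := Goo k.
  split; first exact: measurableX.
  by rewrite product_measure1E// lte_mul_pinfty// ge0_fin_numE.
pose u (x : n.+1.-tuple T) : T * n.-tuple T :=
  (tnth x ord0, [tuple of behead x]).
have uK p : u (tuple_cons p) = p.
  by case: p => a b; congr (_, _); apply: val_inj.
have mu : measurable_fun setT u.
  by apply/measurable_fun_pairP; split;
    [exact: measurable_tnth|exact: measurable_behead].
exists (fun k => u @^-1` F k).
  by rewrite -preimage_bigcup -TF preimage_setT.
move=> k; have [mF Fk] := Foo k; split.
  by rewrite -[X in measurable X]setTI; exact: mu.
rewrite /lebesgue_cons /pushforward.
by rewrite (_ : _ @^-1` _ = F k)//; apply/seteqP; split=> p /=; rewrite uK.
Qed.

HB.instance Definition _ := Measure_isSigmaFinite.Build _ _ _ lebesgue_cons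
  lebesgue_cons_sigma_finite.

End step.

(* The Lebesgue measure on R^n: the n-fold product of the one on R. *)
Fixpoint lebesgue_tuple n : {sigma_finite_measure set (n.-tuple T) -> \bar R} :=
  match n with
  | 0 => \d_([tuple] : 0.-tuple T)
  | n'.+1 => lebesgue_cons (lebesgue_tuple n')
  end.

End lebesgue_tuple.

Section sos.
Context {R : realType} {n : nat}.

Definition cube : set (n.-tuple (measurableTypeR R)) :=
  [set x | forall i, -1 <= tnth x i <= 1].

Definition integral_cube (p : mpoly n R) : R :=
  \int[lebesgue_tuple n]_(x in cube) meval (tnth x) p.

(* [msize p] is 1 plus the total degree of [p], and 0 for [p = 0]. *)
Definition Sigma (d : nat) : set (mpoly n R) :=
  [set p | (msize p <= (2 * d).+1)%N /\
           exists qs : seq (mpoly n R), p = \sum_(q <- qs) q ^+ 2].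

Definition is_min (S : set R) (m : R) := S m /\ lbound S m.

(* The indices 1, ..., N are shifted to 0, ..., N - 1, and N >= 1 is written as
   the successor of M, so that [ord0] plays the role of the index 1. *)
Variables (M : nat) (f g : 'I_M.+1 -> mpoly n R).
Implicit Type sigma : 'I_M.+1 -> mpoly n R.

Definition ratio_sums : set R :=
  [set \sum_(i < M.+1) meval (tnth x) (f i) / meval (tnth x) (g i) |
    x in cube].

Definition rho : R := inf ratio_sums.

Definition moment_gap sigma (a : multinom n) (i : 'I_M.+1) : R :=
  `| integral_cube (mpolyX R a * g i * sigma i)
     - integral_cube (mpolyX R a * g ord0 * sigma ord0) |.

Definition mass_gap sigma : R :=
  `| integral_cube (g ord0 * sigma ord0) - 1 |.

Definition objective sigma : R :=
  \sum_(i < M.+1) integral_cube (f i * sigma i).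

(* [bmultinom n s.+1] is the finite type of exponents of degree at most [s]. *)
Definition Delta_cost (s : nat) sigma : R :=
  Num.max
    (\big[Num.max/0]_(a : bmultinom n s.+1)
       \big[Num.max/0]_(i < M.+1 | i != ord0) moment_gap sigma a i)
    (Num.max (mass_gap sigma) `| objective sigma - rho |).

Definition Delta_costs (d s : nat) : set R :=
  [set Delta_cost s sigma | sigma in [set sigma | forall i, Sigma d (sigma i)]].

Definition Delta (d s : nat) : R := inf (Delta_costs d s).

Definition feasible (s d : nat) (e : R) : set ('I_M.+1 -> mpoly n R) :=
  [set sigma | [/\ forall i, Sigma d (sigma i),
    forall (a : multinom n) (i : 'I_M.+1),
      (mdeg a <= s)%N -> i != ord0 -> moment_gap sigma a i <= e &
    mass_gap sigma <= e]].

(* An infimum in the extended reals: [+oo] when no [sigma] is feasible. *)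
Definition rho_relax (s d : nat) (e : R) : \bar R :=
  ereal_inf [set (objective sigma)%:E | sigma in feasible s d e].

End sos.

(* Main.v *)
(* Positive measures sigma_i dlambda only see moments, so both limits reduce to two
   estimates.
   - Lower bound.  Scale g_i so that y_i = 1 - g_i / A lies in [0, r] on K with r < 1,
     and let u_i = A^-1 (1 + y_i + ... + y_i^(2m)).  Then g_i u_i = 1 - y_i^(2m+1), so
     h_i = f_i u_i approximates f_i / g_i uniformly.  Hence \int f_i sigma_i is close to
     \int h_i g_i sigma_i, which the moment constraints compare with
     \int h_i g_1 sigma_1, and \sum_i h_i is almost bounded below by rho.
   - Upper bound.  The truncated series u_i is a sum of squares because its top degree
     in y_i is even.  If psi^2 dlambda is a probability measure concentrated near a
     minimizer of \sum_i f_i / g_i, then sigma_i = psi^2 u_i has all its gaps bounded by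
     r^(2m+1), while its degree grows only linearly in m; so the gaps are eventually
     below 1 / sqrt d0.
   The minimum defining Delta is attained because a sum of squares of degree at most 2d
   is a sum of a bounded number of squares of degree at most d, and a bound on the cost
   bounds the coefficients of these squares. *)
Require Import Defs.
From mathcomp Require Import all_boot all_order all_algebra.
From mathcomp Require Import -(notations) mpoly.
From mathcomp Require Import all_classical all_reals all_analysis.
From mathcomp Require Import measurable_realfun zify ring lra.
Import Order.TTheory GRing.Theory Num.Theory.
Import numFieldNormedType.Exports.
Set Implicit Arguments.
Unset Strict Implicit.
Unset Printing Implicit Defensive.
Local Open Scope classical_set_scope.
Local Open Scope ring_scope.

(** * The Lebesgue integral of polynomials over the cube *)

Section box.
Context {R : realType}.
Local Notation T := (measurableTypeR R).

(** Boxes serve as the test sets of positive measure around a point; the cube itself is one of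
    them. *)
Definition box n (a b : 'I_n -> R) : set (n.-tuple T) :=
  [set x | forall i, a i <= tnth x i <= b i].

Lemma measurable_box n (a b : 'I_n -> R) : measurable (box a b).
Proof.
rewrite (_ : box a b = \bigcap_(i in [set: 'I_n]) ((fun x => tnth x i) @^-1` `[a i, b
  i])); last first.
  apply/seteqP; split=> x /= h i; first by move=> _ /=; rewrite in_itv /=.
  by have := h i I; rewrite /= in_itv.
apply: fin_bigcap_measurable => // i _.
rewrite -[X in measurable X]setTI; exact: measurable_tnth.
Qed.

(** Splitting off the first coordinate turns the box into the product of an interval and a smaller
    box. *)
Lemma lebesgue_tuple_box n (a b : 'I_n -> R) : (forall i, a i <= b i) ->
  lebesgue_tuple n (box a b) = (\prod_i (b i - a i))%:E.
Proof.
elim: n a b => [|n IH] a b ab.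
  rewrite big_ord0 /= /dirac indicE.
  by rewrite mem_set// => -[].
rewrite /= /lebesgue_cons /pushforward.
rewrite (_ : _ @^-1` _ = `[a ord0, b ord0] `*` box (a \o lift ord0) (b \o lift ord0));
  last first.
  apply/seteqP; split=> -[x y] /=.
    move=> h; split => /=; first by rewrite in_itv /=; have := h ord0; rewrite (tnth_nth 0).
    by move=> i; have := h (lift ord0 i); rewrite (tnth_nth 0) /= -tnth_nth.
  move=> [/= hx hy] i; case: (unliftP ord0 i) => [j|] ->.
    by have := hy j; rewrite /= (tnth_nth 0) /= [X in _ -> _ <= X <= _](tnth_nth 0).
  by rewrite (tnth_nth 0) /=; move: hx; rewrite in_itv.
rewrite product_measure1E //; last exact: measurable_box.
rewrite IH; last by move=> i; exact: ab.
rewrite big_ord_recl EFinM; congr (_ * _)%E.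
apply: etrans (lebesgue_measure_itv `[a ord0, b ord0]) _.
rewrite lte_fin EFinB; case: ltgtP (ab ord0) => //= -> _.
by rewrite subee.
Qed.

End box.

Section eval.
Context {R : realType} {n : nat}.
Local Notation T := (measurableTypeR R).
Implicit Types (p q h : mpoly n R) (x : n.-tuple T).

Lemma measurable_meval p (D : set (n.-tuple T)) :
  measurable_fun D (fun x => meval (tnth x) p).
Proof.
apply: (measurable_funTS).
rewrite (_ : (fun x => _) = (fun x => \sum_(m <- msupp p) (mcoeff m p * \prod_i tnth x i
  ^+ m i))) //.
apply: measurable_sum => m; apply: measurable_funM => //.
apply: measurable_prod => i _; apply: measurable_funX; exact: measurable_tnth.
Qed.

Lemma continuous_meval p : continuous (fun v : 'rV[R]_n => meval (v ord0) p).
Proof.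
rewrite (_ : (fun w => _) = (fun v : 'rV[R]_n => \sum_(m <- msupp p) (mcoeff m p *
  \prod_i v ord0 i ^+ m i))) //.
apply: continuous_big => [|m _]; first exact: add_continuous.
move=> v; apply: continuousM; first exact: cst_continuous.
move: v; apply: continuous_big => [|i _]; first exact: mul_continuous.
move=> v; apply: (@cvg_comp _ _ _ (fun v : 'rV[R]_n => v ord0 i) (fun t : R => t ^+ m i)).
  exact: coord_continuous.
exact: exprn_continuous.
Qed.

Lemma normr_monomial_cube (m : multinom n) x :
  cube x -> `|meval (tnth x) (mpolyX R m)| <= 1.
Proof.
move=> Kx; rewrite mevalX normr_prod.
apply: prodr_ile1 => i _; rewrite normr_ge0 normrX /=.
by rewrite exprn_ile1 // ler_norml Kx.
Qed.

(** The l^1 norm of the coefficients, which bounds [p] on the cube because monomials have modulus at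
    most 1 there. *)
Definition norm1 p : R := \sum_(m <- msupp p) `|mcoeff m p|.

Lemma normr_meval_cube p x : cube x -> `|meval (tnth x) p| <= norm1 p.
Proof.
move=> Kx; rewrite mevalE; apply: le_trans (ler_norm_sum _ _ _) _.
apply: ler_sum => m _; rewrite normrM ler_piMr //.
by rewrite -mevalX normr_monomial_cube.
Qed.

Lemma norm1_ge0 p : 0 <= norm1 p.
Proof. exact: sumr_ge0. Qed.

Lemma cube_box : @cube R n = box (fun=> -1) (fun=> 1).
Proof. by []. Qed.

Lemma measurable_cube : measurable (@cube R n).
Proof. exact: measurable_box. Qed.

Lemma lebesgue_tuple_cube_fin : (lebesgue_tuple n (@cube R n) < +oo)%E.
Proof. by rewrite cube_box lebesgue_tuple_box ?ltry // => i; lra. Qed.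

Lemma integrable_meval p (D : set (n.-tuple T)) : measurable D -> D `<=` @cube R n ->
  (lebesgue_tuple n).-integrable D (EFin \o (fun x => meval (tnth x) p)).
Proof.
move=> mD DK; apply: measurable_bounded_integrable => //.
- apply: le_lt_trans lebesgue_tuple_cube_fin.
  by apply: le_measure => //; rewrite inE //; exact: measurable_cube.
- exact: measurable_meval.
- exists (norm1 p); split; first exact: num_real.
  by move=> y py x /= /DK Kx; apply: le_trans (normr_meval_cube p Kx) (ltW py).
Qed.

Let integrable_cube p := integrable_meval p measurable_cube (@subset_refl _ _).

Lemma integral_cubeD p q : integral_cube (p + q) = integral_cube p + integral_cube q.
Proof.
rewrite /integral_cube -RintegralD //; [|exact: measurable_cube|exact: integrable_cube..].
by apply: eq_Rintegral => x _; rewrite mevalD.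
Qed.

Lemma integral_cubeZ c p : integral_cube (c *: p) = c * integral_cube p.
Proof.
rewrite /integral_cube -RintegralZl //; [|exact: measurable_cube|exact: integrable_cube..].
by apply: eq_Rintegral => x _; rewrite mevalZ.
Qed.

Lemma integral_cube0 : @integral_cube R n 0 = 0.
Proof. by rewrite -(scale0r 0) integral_cubeZ mul0r. Qed.

Lemma integral_cubeN p : integral_cube (- p) = - integral_cube p.
Proof. by rewrite -scaleN1r integral_cubeZ mulN1r. Qed.

Lemma integral_cubeB p q : integral_cube (p - q) = integral_cube p - integral_cube q.
Proof. by rewrite integral_cubeD integral_cubeN. Qed.

Lemma integral_cube_sum I (r : seq I) (P : pred I) (F : I -> mpoly n R) :
  integral_cube (\sum_(i <- r | P i) F i) = \sum_(i <- r | P i) integral_cube (F i).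
Proof. exact: (big_morph _ integral_cubeD integral_cube0). Qed.

Lemma le_integral_cube p q :
  (forall x, cube x -> meval (tnth x) p <= meval (tnth x) q) ->
  integral_cube p <= integral_cube q.
Proof.
by move=> pq; apply: le_Rintegral; [exact: measurable_cube|exact: integrable_cube..|].
Qed.

Lemma integral_cube_ge0 p :
  (forall x, cube x -> 0 <= meval (tnth x) p) -> 0 <= integral_cube p.
Proof. by move=> p0; rewrite -integral_cube0; apply: le_integral_cube => x /p0;
  rewrite meval0. Qed.

Lemma normr_integral_cube p q :
  (forall x, cube x -> `|meval (tnth x) p| <= meval (tnth x) q) ->
  `|integral_cube p| <= integral_cube q.
Proof.
move=> pq; rewrite ler_norml -integral_cubeN; apply/andP; split;
  apply: le_integral_cube => x /pq.
  by rewrite mevalN ler_norml => /andP[].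
by rewrite ler_norml => /andP[].
Qed.

(* A quantitative form of the fact that the Lebesgue measure has full support. *)
Lemma integral_cube_bump h x0 c0 : cube x0 -> c0 < meval (tnth x0) h ->
  exists2 w : R, 0 < w & forall p (a : R), 0 <= a ->
    (forall x, cube x -> 0 <= meval (tnth x) p) ->
    (forall x, cube x -> c0 < meval (tnth x) h -> a <= meval (tnth x) p) ->
    a * w <= integral_cube p.
Proof.
move=> Kx0 hx0.
(* Continuity of [h] is available on row vectors, so the neighbourhood of [x0] is taken there. *)
pose v0 : 'rV[R]_n := \row_i tnth x0 i.
have hv0 : c0 < meval (v0 ord0) h.
  by rewrite (_ : meval _ h = meval (tnth x0) h) //; apply: meval_eq => i; rewrite mxE.
have : \forall v \near nbhs (v0 : 'rV[R]_n), c0 < meval ((v : 'rV[R]_n) ord0) h.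
  have := @cvgr_gt R _ (nbhs v0) _ _ _ (@continuous_meval h v0) _ hv0; exact.
move=> /nbhs_ballP[e /= e0 he].
(* A box of half-width [e / 2] around [x0], clipped to the cube. It has positive volume even when
   [x0] is on the boundary, and stays in the open ball where [h] exceeds [c0]. *)
pose a i := Num.max (-1) (tnth x0 i - e / 2).
pose b i := Num.min 1 (tnth x0 i + e / 2).
have ab i : a i < b i.
  by have := Kx0 i; rewrite /a /b gt_max !lt_min => /andP[? ?]; lra.
have BK : box a b `<=` @cube R n.
  move=> x hx i; have := hx i; rewrite /a /b ge_max le_min; lra.
have Bh x : box a b x -> c0 < meval (tnth x) h.
  move=> hx; rewrite (_ : meval _ h = meval ((\row_i tnth x i : 'rV[R]_n) ord0) h).
    apply: he; split=> // i j; rewrite !mxE /ball /= ltr_norml.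
    by have := hx j; rewrite /a /b ge_max le_min; lra.
  by apply: meval_eq => i; rewrite mxE.
have mB := measurable_box a b.
exists (\prod_i (b i - a i)); first by apply: prodr_gt0 => i _; rewrite subr_gt0.
move=> p c c_ge0 p_ge0 p_gec.
have -> : \prod_i (b i - a i) = fine (lebesgue_tuple n (box a b)).
  by rewrite lebesgue_tuple_box // => i; exact: ltW.
rewrite -Rintegral_cst //; apply: (@le_trans _ _ (\int[lebesgue_tuple n]_(x in box a b)
  meval (tnth x) p)).
  apply: le_Rintegral => //.
  - rewrite (_ : EFin \o _ = EFin \o (fun x => meval (tnth x) (mpolyC n c))).
      exact: integrable_meval.
    by apply/funext => x /=; rewrite mevalC.
  - exact: integrable_meval.
  - by move=> x Bx; apply: p_gec (BK _ Bx) (Bh _ Bx).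
apply: fine_le.
- exact: (integrable_fin_num mB (integrable_meval p mB BK)).
- exact: (integrable_fin_num measurable_cube (integrable_cube p)).
- apply: ge0_subset_integral => //; first exact: measurable_cube.
    by apply/measurable_EFinP; exact: measurable_meval.
Qed.

End eval.

(** * Positive definiteness of the integral and bounds on coefficients *)

(** Reduction modulo [B] isolates the lowest digit. This keeps distinct monomials distinct under the
    Kronecker substitution. *)
Lemma base_expansion_inj (B n : nat) (u v : 'I_n -> nat) :
  (forall i, u i < B)%N -> (forall i, v i < B)%N ->
  (\sum_i u i * B ^ i = \sum_i v i * B ^ i)%N -> u =1 v.
Proof.
elim: n u v => [|n IH] u v uB vB; first by move=> _ [].
rewrite !big_ord_recl /= !expn0 !muln1.
have shift w : (\sum_(i < n) w (lift ord0 i) * B ^ bump 0 i =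
    (\sum_(i < n) w (lift ord0 i) * B ^ i) * B)%N.
  by rewrite big_distrl /=; apply: eq_bigr => i _; rewrite -mulnA -expnSr.
rewrite !shift => E.
have B0 : (0 < B)%N by apply: leq_ltn_trans (uB ord0).
have E0 : u ord0 = v ord0.
  have /(congr1 (modn^~ B)) := E.
  by rewrite ![(_ ord0 + _)%N]addnC !modnMDl !modn_small.
have {}IH := IH (u \o lift ord0) (v \o lift ord0) (fun i => uB _) (fun i => vB _).
move: E; rewrite E0 => /addnI /eqP; rewrite eqn_pmul2r // => /eqP /IH uv i.
by case: (unliftP ord0 i) => [j|] -> //; exact: uv.
Qed.

Section positivity.
Context {R : realType} {n : nat}.
Implicit Types (p q w : mpoly n R).

(* Kronecker substitution [x_i := t ^ (B ^ i)]. *)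
Lemma meval_cube_eq0 p : (forall x, cube x -> meval (tnth x) p = 0) -> p = 0.
Proof.
(* [B] exceeds every exponent occurring in [p], so [e] reads the exponents of a monomial as digits
   in base [B]. *)
move=> p0; pose B := msize p; pose e (m : multinom n) := (\sum_(i < n) m i * B ^ i)%N.
have mB (m : multinom n) i : m \in msupp p -> (m i < B)%N.
  move=> /msize_mdeg_lt; apply: leq_ltn_trans.
  by rewrite mdegE (bigD1 i) //= leq_addr.
pose P : {poly R} := \sum_(m <- msupp p) mcoeff m p *: 'X^(e m).
have hP (t : R) : 0 <= t <= 1 -> P.[t] = 0.
  move=> /andP[t0 t1]; rewrite -(p0 [tuple t ^+ (B ^ i) | i < n]).
    rewrite mevalE horner_sum; apply: eq_bigr => m _.
    rewrite hornerZ hornerXn; congr (_ * _).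
    rewrite /e -prodrXr; apply: eq_bigr => i _.
    by rewrite tnth_mktuple -exprM mulnC.
  move=> i; rewrite tnth_mktuple; apply/andP; split.
    by apply: le_trans (exprn_ge0 _ t0); lra.
  exact: exprn_ile1.
(* [P] has the [size P] distinct roots [1, 1/2, 1/3, ...] in the unit interval, too many for a
   nonzero polynomial. *)
have P0 : P = 0.
  apply: (@roots_geq_poly_eq0 _ P [seq k.+1%:R^-1 | k <- iota 0 (size P)]).
  - apply/allP => t /mapP[k _ ->]; apply/rootP/hP.
    by rewrite invr_ge0 ler0n /= invf_le1 ?ltr0n // ler1n.
  - rewrite map_inj_uniq ?iota_uniq // => j k /invr_inj /eqP.
    by rewrite eqr_nat eqSS => /eqP.
  - by rewrite size_map size_iota.
apply/mpolyP => m; rewrite mcoeff0.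
have [mp|] := boolP (m \in msupp p); last by rewrite mcoeff_msupp negbK => /eqP.
have : P`_(e m) = 0 by rewrite P0 coef0.
rewrite coef_sum (bigD1_seq m) //= coefZ coefXn eqxx mulr1 big_seq_cond big1 ?addr0 //.
move=> k /andP[kp km]; rewrite coefZ coefXn; case: eqP; last by rewrite mulr0.
move=> /base_expansion_inj E; case/eqP: km; apply/mnmP => i; apply/esym/E => j; exact: mB.
Qed.

(** A nonzero [p] is nonzero somewhere on the cube, and [p * p] stays above half its value there on
    a set of positive measure. *)
Lemma integral_cube_sqr_gt0 p : p != 0 -> 0 < integral_cube (p * p).
Proof.
move=> p0; have [x [Kx px]] : exists x, cube x /\ meval (tnth x) p != 0.
  apply: contrapT => h; case/eqP: p0; apply: meval_cube_eq0 => x Kx.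
  by apply: contrapT => /eqP px; apply: h; exists x.
have s0 : 0 < meval (tnth x) (p * p) by rewrite mevalM -expr2 exprn_even_gt0.
have hlt : meval (tnth x) (p * p) / 2 < meval (tnth x) (p * p) by lra.
have [w w0 hw] := integral_cube_bump Kx hlt.
apply: lt_le_trans (hw (p * p) (meval (tnth x) (p * p) / 2) _ _ _).
- by rewrite mulr_gt0 // divr_gt0.
- by rewrite ltW // divr_gt0.
- by move=> y _; rewrite mevalM -expr2 sqr_ge0.
- by move=> y _; apply: ltW.
Qed.

Lemma integral_cube_sqr_ge0 p : 0 <= integral_cube (p * p).
Proof. by apply: integral_cube_ge0 => x _; rewrite mevalM -expr2 sqr_ge0. Qed.

(** The Gram matrix of the monomials is invertible by positive definiteness; the rows of its inverse
    give polynomials that represent the coefficient functionals. *)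
Lemma dual_monomials d : exists w : bmultinom n d.+1 -> mpoly n R,
  forall q, (msize q <= d.+1)%N -> forall a : bmultinom n d.+1,
    mcoeff a q = integral_cube (q * w a).
Proof.
pose N := #|{: bmultinom n d.+1}|.
pose X (i : 'I_N) : mpoly n R := mpolyX R (enum_val i : bmultinom n d.+1).
pose G : 'M[R]_N := \matrix_(i, j) integral_cube (X i * X j).
have Gu : G \in unitmx.
  rewrite -row_free_unit; apply: inj_row_free => v vG.
  pose q := \sum_i v ord0 i *: X i.
  have qq : integral_cube (q * q) = 0.
    rewrite {2}/q mulr_sumr integral_cube_sum big1 // => j _.
    rewrite -scalerAr integral_cubeZ /q mulr_suml integral_cube_sum.
    have := congr1 (fun A : 'rV[R]_N => A ord0 j) vG; rewrite !mxE => E.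
    rewrite -[RHS](mulr0 (v ord0 j)); congr (_ * _); rewrite -[RHS]E.
    by apply: eq_bigr => i _; rewrite -scalerAl integral_cubeZ mxE.
  have q0 : q = 0.
    by apply/eqP; apply: contraT => /integral_cube_sqr_gt0; rewrite qq ltxx.
  apply/rowP => i; rewrite mxE.
  have : mcoeff (enum_val i : bmultinom n d.+1) q = 0 by rewrite q0 mcoeff0.
  rewrite /q raddf_sum (bigD1 i) //= mcoeffZ mcoeffX eqxx mulr1 big1 ?addr0 //.
  move=> j ji; rewrite mcoeffZ mcoeffX -bmeqP (inj_eq enum_val_inj) (negbTE ji).
  by rewrite mulr0.
exists (fun a => \sum_j invmx G j (enum_rank a) *: X j) => q qd a.
have qE : q = \sum_i mcoeff (enum_val i : bmultinom n d.+1) q *: X i.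
  rewrite {1}(mpolywE qd) (reindex (enum_val : 'I_N -> bmultinom n d.+1)) //.
  exact: onW_bij (@enum_val_bij _).
rewrite {2}qE mulr_suml integral_cube_sum.
transitivity ((\row_i mcoeff (enum_val i : bmultinom n d.+1) q *m G *m invmx G) ord0
  (enum_rank a)).
  by rewrite mulmxK // mxE enum_rankK.
rewrite -mulmxA mxE; apply: eq_bigr => i _; rewrite !mxE -scalerAl integral_cubeZ.
congr (_ * _); rewrite mulr_sumr integral_cube_sum; apply: eq_bigr => j _.
by rewrite -scalerAr integral_cubeZ mxE mulrC.
Qed.

(** A coefficient is the inner product of [q] with a dual polynomial [w a], and integrating
    [(q + w a) ^ 2] and [(q - w a) ^ 2] bounds it. Summing over [a] makes the constant uniform. *)
Lemma mcoeff_bound d : exists C : R, forall q, (msize q <= d.+1)%N ->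
  forall a : bmultinom n d.+1, `|mcoeff a q| <= integral_cube (q * q) + C.
Proof.
have [w hw] := dual_monomials d.
exists (\sum_a integral_cube (w a * w a)) => q qd a.
have wC : integral_cube (w a * w a) <= \sum_a integral_cube (w a * w a).
  by rewrite (bigD1 a) //= lerDl sumr_ge0 // => b _; exact: integral_cube_sqr_ge0.
have q0 := integral_cube_sqr_ge0 q; have w0 := integral_cube_sqr_ge0 (w a).
have hp := integral_cube_sqr_ge0 (q + w a).
have hm := integral_cube_sqr_ge0 (q - w a).
have Ep : (q + w a) * (q + w a) = q * q + 2 *: (q * w a) + w a * w a.
  by rewrite scaler_nat; ring.
have Em : (q - w a) * (q - w a) = q * q - 2 *: (q * w a) + w a * w a.
  by rewrite scaler_nat; ring.
rewrite (hw _ qd); move: hp hm;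
  rewrite Ep Em !(integral_cubeD, integral_cubeN, integral_cubeZ).
by rewrite ler_norml; lra.
Qed.

End positivity.

(** * Sums of squares of bounded degree *)

Section sos.
Context {R : realType} {n : nat}.
Implicit Types (p q : mpoly n R) (d : nat).

Lemma msizeM_pred p q : (msize (p * q) <= (msize p + msize q).-1)%N.
Proof.
have [->|p0] := eqVneq p 0; first by rewrite mul0r msize0.
have [->|q0] := eqVneq q 0; first by rewrite mulr0 msize0.
by rewrite msizeM.
Qed.

Lemma msizeM_deg p q a b : (msize p <= a.+1)%N -> (msize q <= b.+1)%N ->
  (msize (p * q) <= (a + b).+1)%N.
Proof. by have := msizeM_pred p q; lia. Qed.

Lemma msizeX_deg p k a : (msize p <= a.+1)%N -> (msize (p ^+ k) <= (k * a).+1)%N.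
Proof.
move=> pa; elim: k => [|k IH]; first by rewrite expr0 msize1.
by rewrite exprS mulSn; exact: msizeM_deg.
Qed.

Lemma msize_sum_deg (I : Type) (r : seq I) (P : pred I) (F : I -> mpoly n R) k :
  (forall i, P i -> (msize (F i) <= k)%N) -> (msize (\sum_(i <- r | P i) F i) <= k)%N.
Proof.
move=> Fk; elim/big_ind: _ => //; first by rewrite msize0.
by move=> p q pk qk; apply: leq_trans (mmeasureD_le _ _ _) _; rewrite geq_max pk.
Qed.

Lemma ex_max_mlead p (qs : seq (mpoly n R)) :
  exists2 q0, q0 \in p :: qs & forall q, q \in p :: qs -> (mlead q <= mlead q0)%O.
Proof.
elim: qs p => [|p1 qs IH] p.
  by exists p; rewrite ?inE // => q; rewrite inE => /eqP ->.
have [q0 q0s q0max] := IH p1.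
have [le|lt] := leP (mlead p) (mlead q0).
  exists q0; first by rewrite inE q0s orbT.
  by move=> q; rewrite inE => /orP[/eqP->|/q0max].
exists p; first by rewrite inE eqxx.
move=> q; rewrite inE => /orP[/eqP->//|/q0max qq0]; exact: le_trans qq0 (ltW lt).
Qed.

(* The squares of the largest leading monomial cannot cancel. *)
Lemma msize_sum_sqr d (qs : seq (mpoly n R)) :
  (msize (\sum_(q <- qs) q ^+ 2) <= (2 * d).+1)%N ->
  forall q, q \in qs -> (msize q <= d.+1)%N.
Proof.
case: qs => // p0 qs; have [q0 q0s q0max] := ex_max_mlead p0 qs.
move: (p0 :: qs) q0s q0max => s q0s q0max sd.
pose m := mlead q0.
have md : (mdeg m <= d)%N.
  have [q00|q0n] := eqVneq q0 0; first by rewrite /m q00 mlead0 mdeg0.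
  suff : (mnm_add m m) \in msupp (\sum_(q <- s) q ^+ 2).
    move=> /msize_mdeg_lt; rewrite mdegD; lia.
  rewrite mcoeff_msupp raddf_sum /=.
  (* As [m] dominates every leading monomial, only the pair [m], [m] contributes to the coefficient
     of [q ^+ 2] at [m + m]. *)
  have -> : \sum_(q <- s) mcoeff (mnm_add m m) (q ^+ 2) = \sum_(q <- s) mcoeff m q ^+ 2.
    by apply: eq_big_seq => q qs'; rewrite expr2 mleadcMW ?expr2 //; exact: q0max.
  rewrite psumr_eq0; last by move=> q _; exact: sqr_ge0.
  apply/allPn; exists q0 => //=; rewrite expf_eq0 /=.
  by rewrite mleadc_eq0.
move=> q /q0max /lemc_mdeg qm.
have [->|q0'] := eqVneq q 0; first by rewrite msize0.
by rewrite -mlead_deg // ltnS (leq_trans qm).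
Qed.

Definition monomial_comb d (c : bmultinom n d.+1 -> R) : mpoly n R :=
  \sum_a c a *: mpolyX R a.

Lemma mcoeff_monomial_comb d (c : bmultinom n d.+1 -> R) (a : bmultinom n d.+1) :
  mcoeff a (monomial_comb c) = c a.
Proof.
rewrite raddf_sum (bigD1 a) //= mcoeffZ mcoeffX eqxx mulr1 big1 ?addr0 // => b ba.
by rewrite mcoeffZ mcoeffX -bmeqP (negbTE ba) mulr0.
Qed.

Lemma msize_monomial_comb d (c : bmultinom n d.+1 -> R) :
  (msize (monomial_comb c) <= d.+1)%N.
Proof.
apply: msize_sum_deg => a _; apply: leq_trans (msizeZ_le _ _) _.
by rewrite msizeX; exact: bmdeg.
Qed.

Lemma monomial_combE d q : (msize q <= d.+1)%N ->
  q = monomial_comb (fun a : bmultinom n d.+1 => mcoeff a q).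
Proof. exact: mpolywE. Qed.

Notation nmon d := #|{: bmultinom n d.+1}|.

(* If [q_j = \sum_i b_i q_i] then [\sum_i q_i ^ 2 + q_j ^ 2] is a sum of squares of
   the [q_i + t b_i q_j], where [2 t + t ^ 2 |b| ^ 2 = 1]. *)
Lemma sum_sqr_absorb N (q : 'I_N -> mpoly n R) (b : 'I_N -> R) :
  let S := \sum_i b i *: q i in
  exists t : R, \sum_i (q i + (t * b i) *: S) ^+ 2 = S ^+ 2 + \sum_i q i ^+ 2.
Proof.
move=> S; pose beta := \sum_i b i ^+ 2; pose r := Num.sqrt (1 + beta).
have beta0 : 0 <= beta by apply: sumr_ge0 => i _; exact: sqr_ge0.
have r2 : r ^+ 2 = 1 + beta by rewrite sqr_sqrtr // addr_ge0.
have r0 : 0 <= r := sqrtr_ge0 _.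
(* The positive root of [2 t + t ^ 2 beta = 1], in the rationalized form that remains valid for
   [beta = 0]. *)
pose t := (1 + r)^-1; exists t.
have t1 : 2 * t + t ^+ 2 * beta = 1.
  have -> : beta = r ^+ 2 - 1 by rewrite r2; lra.
  by rewrite /t; field; lra.
transitivity (\sum_i (q i ^+ 2 + (2 * t) *: ((b i *: q i) * S) + (t ^+ 2 * b i ^+ 2) *: S
  ^+ 2)).
  apply: eq_bigr => i _; rewrite -!mul_mpolyC !(mpolyCM, mpolyCD); ring.
rewrite !big_split /= -scaler_sumr -mulr_suml -/S -scaler_suml -mulr_sumr -/beta.
by rewrite -expr2 -addrA -scalerDl t1 scale1r addrC.
Qed.

(** More than [nmon d] polynomials of degree at most [d] are linearly dependent, so one of them is a
    combination of the others and its square can be absorbed. This is repeated [k] times. *)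
Lemma sum_sqr_reduce d k (q : 'I_(nmon d + k) -> mpoly n R) :
  (forall i, msize (q i) <= d.+1)%N ->
  exists2 q' : 'I_(nmon d) -> mpoly n R, (forall i, msize (q' i) <= d.+1)%N &
    \sum_i q i ^+ 2 = \sum_i q' i ^+ 2.
Proof.
elim: k q => [|k IH]; first by rewrite addn0 => q qd; exists q.
rewrite addnS => q qd.
pose Q : 'M[R]_((nmon d + k).+1, nmon d) :=
  \matrix_(i, a) mcoeff (enum_val a : bmultinom n d.+1) (q i).
have [c [cQ c0]] : exists c : 'rV[R]_((nmon d + k).+1), c *m Q = 0 /\ c != 0.
  apply: contrapT => h; have : row_free Q.
    apply: inj_row_free => v vQ; apply: contrapT => /eqP v0; apply: h.
    by exists v.
  by rewrite /row_free => /eqP rQ; have := rank_leq_col Q; rewrite rQ; lia.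
have cq : \sum_i c ord0 i *: q i = 0.
  have sd : (msize (\sum_i c ord0 i *: q i) <= d.+1)%N.
    by apply: msize_sum_deg => i _; exact: leq_trans (msizeZ_le _ _) (qd i).
  rewrite (monomial_combE sd) /monomial_comb big1 // => a _.
  rewrite raddf_sum /=.
  have := congr1 (fun A : 'rV[R]__ => A ord0 (enum_rank a)) cQ; rewrite !mxE => E.
  rewrite (_ : \sum_i _ = 0) ?scale0r // -[RHS]E; apply: eq_bigr => i _.
  by rewrite mcoeffZ mxE enum_rankK.
have [j cj] : exists j, c ord0 j != 0.
  apply: contrapT => h; case/eqP: c0; apply/rowP => j; rewrite mxE.
  by apply: contrapT => /eqP cj; apply: h; exists j.
pose b i := - (c ord0 (lift j i) / c ord0 j).
pose S := \sum_i b i *: q (lift j i).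
have qjE : q j = S.
  apply: (scalerI cj); rewrite scaler_sumr.
  move/eqP: cq; rewrite (bigD1_ord j) //= addr_eq0 => /eqP ->.
  rewrite -sumrN; apply: eq_bigr => i _; rewrite -scaleNr scalerA; congr (_ *: _).
  by rewrite /b; field.
have [t ht] := sum_sqr_absorb (q \o lift j) b.
have [|q' q'd q'E] := IH (fun i => q (lift j i) + (t * b i) *: S).
  move=> i; apply: leq_trans (mmeasureD_le _ _ _) _; rewrite geq_max qd /=.
  by apply: leq_trans (msizeZ_le _ _) _; rewrite -qjE qd.
by exists q' => //; rewrite -q'E ht (bigD1_ord j) //= qjE.
Qed.

(** The uniform number of squares makes [Sigma d] the image of a finite-dimensional space, where
    compactness can be used. *)
Lemma SigmaP d p : Sigma d p <->
  exists c : 'I_(nmon d) -> bmultinom n d.+1 -> R, p = \sum_i monomial_comb (c i) ^+ 2.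
Proof.
split=> [[pd [qs pE]]|[c ->]]; last first.
  split.
    apply: msize_sum_deg => i _; rewrite mul2n -addnn expr2.
    by apply: msizeM_deg; exact: msize_monomial_comb.
  by exists [seq monomial_comb (c i) | i <- enum 'I_(nmon d)]; rewrite big_map big_enum.
have qd : forall q, q \in qs -> (msize q <= d.+1)%N.
  by apply: msize_sum_sqr; rewrite -pE.
(* The subtraction is truncated: when there are fewer than [nmon d] squares, [k] is 0 and [nth] pads
   the list with zeros. *)
pose k := (size qs - nmon d)%N.
pose q (i : 'I_(nmon d + k)) := nth 0 qs i.
have [|q' q'd q'E] := @sum_sqr_reduce d k q.
  move=> i; rewrite /q; have [lt|ge] := ltnP i (size qs); first by apply/qd/mem_nth.
  by rewrite nth_default // msize0.
exists (fun i (a : bmultinom n d.+1) => mcoeff a (q' i)).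
rewrite (_ : \sum_i _ = \sum_i q' i ^+ 2); last first.
  by apply: eq_bigr => i _; rewrite -monomial_combE.
rewrite -q'E pE (big_nth 0) -(big_mkord predT (fun i => nth 0 qs i ^+ 2)) /=.
rewrite [RHS](@big_cat_nat _ _ _ (size qs)) //=; last by rewrite -leq_subLR.
rewrite [X in _ = _ + X]big_nat_cond [X in _ = _ + X]big1 ?addr0 // => i /andP[/andP[si
  _] _].
by rewrite nth_default // expr0n.
Qed.

End sos.

(** * Attainment of the minima *)

(** [rho] and [Delta] are defined as infima, so attainment reduces to exhibiting a lower bound that
    belongs to the set. *)
Lemma is_min_inf (R : realType) (S : set R) m : S m -> lbound S m -> is_min S (inf S).
Proof.
move=> Sm lm; suff -> : inf S = m by split.
apply/eqP; rewrite eq_le; apply/andP; split.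
  by apply: ge_inf => //; exists m.
by apply: lb_le_inf => //; exists m.
Qed.

Lemma for_continuous_sum (R : realType) (T : topologicalType) (I : Type) (r : seq I)
    (F : I -> T -> R) (x : T) :
  (forall i, {for x, continuous (F i)}) ->
  {for x, continuous (fun v => \sum_(i <- r) F i v)}.
Proof.
move=> cF; apply: (@cvg_big _ _ +%R 0 xpredT _ T (nbhs x)) => [|i _]; last exact: cF.
exact: add_continuous.
Qed.

(** The extreme value theorem, used both on the cube and on a box of coefficients. Continuity is
    asked only at points of the box, since the quotients [f_i / g_i] may be discontinuous
    elsewhere. *)
Lemma box_min (R : realType) k (a b : 'I_k -> R) (F : 'rV[R]_k -> R) :
  (forall i, a i <= b i) ->
  (forall v : 'rV[R]_k, (forall i, a i <= v ord0 i <= b i) -> {for v, continuous F}) ->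
  exists2 v : 'rV[R]_k, (forall i, a i <= v ord0 i <= b i) &
    forall u : 'rV[R]_k, (forall i, a i <= u ord0 i <= b i) -> F v <= F u.
Proof.
move=> ab cF; pose B := [set v : 'rV[R]_k | forall i, `[a i, b i]%classic (v ord0 i)].
have BP v : B v <-> forall i, a i <= v ord0 i <= b i.
  by split=> h i; have := h i; rewrite /= in_itv.
have [|||v vB vmin] := @compact_EVT_min _ R F B.
- exists (\row_i a i); apply/BP => i; rewrite mxE; rewrite lexx; exact: ab.
- by apply: (@rV_compact _ _ (fun i => `[a i, b i]%classic)) => i; exact: segment_compact.
- by apply: continuous_in_subspaceT => v; rewrite inE => /BP; exact: cF.
- by rewrite inE in vB; exists v; [exact/BP|move=> u /BP uB; apply: vmin; rewrite inE].
Qed.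

Section cube_min.
Context {R : realType} {n : nat}.

Lemma cube_continuous_min (F : 'rV[R]_n -> R) :
  (forall x : n.-tuple (measurableTypeR R), cube x ->
    {for \row_i tnth x i, continuous F}) ->
  exists2 x : n.-tuple (measurableTypeR R), cube x &
    forall y : n.-tuple (measurableTypeR R), cube y ->
      F (\row_i tnth x i) <= F (\row_i tnth y i).
Proof.
move=> cF.
have rowE (v : 'rV[R]_n) : v = \row_i tnth [tuple v ord0 i | i < n] i.
  by apply/rowP => i; rewrite mxE tnth_mktuple.
have [||v vK vmin] := @box_min R n (fun=> -1) (fun=> 1) F.
- by move=> i; lra.
- by move=> v hv; rewrite (rowE v); apply: cF => i; rewrite tnth_mktuple.
- exists [tuple v ord0 i | i < n]; first by move=> i; rewrite tnth_mktuple.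
  by move=> y Ky; rewrite -rowE; apply: vmin => i; rewrite mxE.
Qed.

Lemma meval_row (p : mpoly n R) (x : n.-tuple (measurableTypeR R)) :
  meval ((\row_i tnth x i : 'rV[R]_n) ord0) p = meval (tnth x) p.
Proof. by apply: meval_eq => i; rewrite mxE. Qed.

Lemma meval_cube_gt0 (p : mpoly n R) :
  (forall x, cube x -> 0 < meval (tnth x) p) ->
  exists2 c, 0 < c & forall x, cube x -> c <= meval (tnth x) p.
Proof.
move=> p0.
have [|x Kx xmin] := @cube_continuous_min (fun v => meval (v ord0) p).
  by move=> x _; exact: continuous_meval.
exists (meval (tnth x) p); first exact: p0.
by move=> y /xmin; rewrite !meval_row.
Qed.

Section ratio.
Variables (M : nat) (f g : 'I_M.+1 -> mpoly n R).
Hypothesis g_gt0 : forall i x, cube x -> 0 < meval (tnth x) (g i).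

Lemma ratio_sums_min : is_min (ratio_sums f g) (rho f g).
Proof.
pose F (v : 'rV[R]_n) := \sum_(i < M.+1) meval (v ord0) (f i) / meval (v ord0) (g i).
have FE x : F (\row_i tnth x i) = \sum_(i < M.+1) meval (tnth x) (f i) / meval (tnth x)
  (g i).
  by apply: eq_bigr => i _; rewrite !meval_row.
have [|x Kx xmin] := @cube_continuous_min F.
  move=> x Kx; apply: for_continuous_sum => i.
  apply: continuousM; first exact: continuous_meval.
  apply: continuousV; last exact: continuous_meval.
  by rewrite meval_row gt_eqF // g_gt0.
apply: (@is_min_inf _ _ (F (\row_i tnth x i))).
  by exists x.
by move=> _ [y Ky <-]; rewrite -FE; exact: xmin.
Qed.

(** With one constant on both sides, [g_i / A] lies between [A^-2] and 1, so the geometric series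
    for [A / g_i] converges uniformly on the cube. *)
Lemma two_sided_bound : exists2 A : R, 1 <= A &
  forall i x, cube x -> A^-1 <= meval (tnth x) (g i) <= A.
Proof.
have /choice[c hc] : forall i, exists c, 0 < c /\ forall x, cube x -> c <= meval (tnth x)
  (g i).
  by move=> i; have [c c0 hc] := meval_cube_gt0 (g_gt0 i); exists c.
(* [A] dominates 1, every [1 / c i] and every [norm1 (g i)] at once. *)
pose A := 1 + \sum_i ((c i)^-1 + norm1 (g i)).
have t0 i : 0 <= (c i)^-1 + norm1 (g i).
  by rewrite addr_ge0 ?norm1_ge0 // invr_ge0 ltW // (hc i).1.
have s0 : 0 <= \sum_i ((c i)^-1 + norm1 (g i)) by apply: sumr_ge0.
exists A => [|i x Kx]; first by rewrite /A; lra.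
have Ai : (c i)^-1 + norm1 (g i) <= A.
  rewrite /A (bigD1 i) //= -[leLHS]add0r lerD // lerDl.
  by apply: sumr_ge0.
have [ci hci] := hc i; have ci' : 0 < (c i)^-1 by rewrite invr_gt0.
have ng := norm1_ge0 (g i).
apply/andP; split.
  apply: le_trans (hci _ Kx); rewrite -[c i]invrK lef_pV2 ?posrE //; last by rewrite /A;
    lra.
  lra.
have := normr_meval_cube (g i) Kx; have := ler_norm (meval (tnth x) (g i)); lra.
Qed.

End ratio.
End cube_min.

(** * Compactness in the space of coefficients *)

Section Delta_min.
Context {R : realType} {n : nat}.
Variables (M : nat) (f g : 'I_M.+1 -> mpoly n R).
Implicit Types (sigma : 'I_M.+1 -> mpoly n R) (d s : nat).

(** The default value 0 of the maxima is harmless because [0 <= C]; this covers the case [M = 0],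
    where the inner maximum is empty. *)
Lemma Delta_costP s sigma (C : R) : 0 <= C -> Delta_cost f g s sigma <= C <->
  [/\ forall (a : multinom n) i, (mdeg a <= s)%N -> i != ord0 -> moment_gap g sigma a i
    <= C,
      mass_gap g sigma <= C & `|objective f sigma - rho f g| <= C].
Proof.
move=> C0; rewrite /Delta_cost !ge_max; split=> [/and3P[hm -> ->]|[hm -> ->]]; last first.
  rewrite !andbT; apply: bigmax_le => // a _; apply: bigmax_le => // i i0.
  by apply: hm => //; rewrite -ltnS bmdeg.
split=> // a i; rewrite -ltnS => sa i0; apply: le_trans hm.
apply: (bigmax_sup (BMultinom sa)) => //.
exact: (bigmax_sup i).
Qed.

Lemma Delta_cost_ge0 s sigma : 0 <= Delta_cost f g s sigma.
Proof. by rewrite /Delta_cost !le_max normr_ge0 orbT. Qed.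

Section param.
Variable d : nat.
Notation nmon := #|{: bmultinom n d.+1}|.
Notation index := ('I_M.+1 * 'I_nmon * bmultinom n d.+1)%type.

(** All coefficients of all squares in all the [sigma_i], laid out as one real vector so that the
    topology of row vectors applies. *)
Definition param_coef (v : 'rV[R]_#|{: index}|) (i : 'I_M.+1) (k : 'I_nmon)
  (a : bmultinom n d.+1) : R := v ord0 (enum_rank (i, k, a)).

Definition param_sos v (i : 'I_M.+1) : mpoly n R :=
  \sum_k monomial_comb (param_coef v i k) ^+ 2.

Lemma param_sosP sigma :
  (forall i, Sigma d (sigma i)) <-> exists v, sigma = param_sos v.
Proof.
split=> [/(_ _)/SigmaP-/choice[c hc]|[v ->] i]; last first.
  by apply/SigmaP; exists (param_coef v i).
exists (\row_j let: (i, k, a) := enum_val j in c i k a).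
apply/funext => i; rewrite hc; apply: eq_bigr => k _; congr (monomial_comb _ ^+ 2).
by apply/funext => a; rewrite /param_coef mxE enum_rankK.
Qed.

Lemma continuous_param_coef i k a : continuous (fun v => param_coef v i k a).
Proof. exact: coord_continuous. Qed.

(** The integral is a quadratic form in the coefficients. *)
Lemma continuous_integral_param h i :
  continuous (fun v => integral_cube (h * param_sos v i)).
Proof.
have E v : integral_cube (h * param_sos v i) = \sum_k \sum_a \sum_b
    param_coef v i k a * (param_coef v i k b *
      integral_cube (h * (mpolyX R (a : bmultinom n d.+1) * mpolyX R (b : bmultinom n
        d.+1)))).
  rewrite mulr_sumr integral_cube_sum; apply: eq_bigr => k _.
  rewrite expr2 {1}/monomial_comb mulr_suml mulr_sumr integral_cube_sum.
  apply: eq_bigr => a _; rewrite /monomial_comb !mulr_sumr integral_cube_sum.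
  apply: eq_bigr => b _.
  by rewrite -scalerAl -3![in LHS]scalerAr 2!integral_cubeZ.
rewrite (funext E) => v.
apply: for_continuous_sum => k; apply: for_continuous_sum => a.
apply: for_continuous_sum => b.
apply: continuousM; first exact: continuous_param_coef.
apply: continuousM; first exact: continuous_param_coef.
exact: cst_continuous.
Qed.

Lemma continuous_Delta_cost s : continuous (fun v => Delta_cost f g s (param_sos v)).
Proof.
have cnorm (F : 'rV[R]_#|{: index}| -> R) : continuous F -> continuous (fun v => `|F v|).
  by move=> cF v; apply: continuous_comp; [exact: cF|exact: norm_continuous].
have csub (F G : 'rV[R]_#|{: index}| -> R) :
    continuous F -> continuous G -> continuous (fun v => F v - G v).
  by move=> cF cG v; exact: (cvgB (@cF v) (@cG v)).
have ccst (c : R) : continuous (fun _ : 'rV[R]_#|{: index}| => c).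
  by move=> v; exact: cst_continuous.
have cgap a i : continuous (fun v => moment_gap g (param_sos v) a i).
  by apply/cnorm/csub; exact: continuous_integral_param.
have cmass : continuous (fun v => mass_gap g (param_sos v)).
  by apply/cnorm/csub => //; exact: continuous_integral_param.
have cobj : continuous (fun v => `|objective f (param_sos v) - rho f g|).
  apply/cnorm/csub => // v.
  by apply: for_continuous_sum => i; exact: continuous_integral_param.
have cmax (F G : 'rV[R]_#|{: index}| -> R) :
    continuous F -> continuous G -> continuous (fun v => Num.max (F v) (G v)).
  by move=> cF cG v; exact: (continuous_max (@cF v) (@cG v)).
apply: (cmax _ _ _ (cmax _ _ cmass cobj)).
apply: continuous_big => [|a _]; first exact: max_continuous.
apply: continuous_big => [|i _]; first exact: max_continuous.
exact: cgap.
Qed.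

Hypothesis g_gt0 : forall i x, cube x -> 0 < meval (tnth x) (g i).

(** The cost bounds the mass of [g_1 sigma_1], then through the gap at exponent 0 that of every
    [g_i sigma_i], then that of [sigma_i] since [g_i >= 1 / A]. Each square is below [sigma_i], and
    [mcoeff_bound] bounds its coefficients. *)
Lemma param_bounded s C : 0 <= C -> exists B : R, forall v,
  Delta_cost f g s (param_sos v) <= C -> forall j, `|v ord0 j| <= B.
Proof.
move=> C0; have [A A1 hA] := two_sided_bound g_gt0.
have [C' hC'] := @mcoeff_bound R n d.
exists (A * (1 + 2 * C) + C') => v /(Delta_costP _ _ C0)[hgap hmass _] j.
rewrite -(enum_valK j); case: (enum_val j) => -[i k] a.
have -> : v ord0 (enum_rank (i, k, a)) = mcoeff a (monomial_comb (param_coef v i k)).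
  by rewrite mcoeff_monomial_comb.
apply: le_trans (hC' _ (msize_monomial_comb _) a) _; rewrite lerD2r.
set q := monomial_comb _.
have q_le : integral_cube (q * q) <= integral_cube (param_sos v i).
  apply: le_integral_cube => x _; rewrite /param_sos (bigD1 k) //= mevalD -expr2 lerDl.
  by rewrite raddf_sum; apply: sumr_ge0 => l _ /=; rewrite expr2 mevalM -expr2 sqr_ge0.
apply: le_trans q_le _; rewrite -ler_pdivrMl; last by lra.
apply: (@le_trans _ _ (integral_cube (g i * param_sos v i))).
  rewrite -integral_cubeZ; apply: le_integral_cube => x Kx; rewrite mevalZ mevalM.
  apply: ler_wpM2r; last by have /andP[] := hA i x Kx.
  rewrite /param_sos raddf_sum; apply: sumr_ge0 => l _ /=.
  by rewrite expr2 mevalM -expr2 sqr_ge0.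
have g0_le : integral_cube (g ord0 * param_sos v ord0) <= 1 + C.
  by move: hmass; rewrite /mass_gap ler_norml; lra.
have [->|i0] := eqVneq i ord0; first by lra.
have := hgap (@mnm0 n) i; rewrite mdeg0 => /(_ isT i0).
by rewrite /moment_gap mpolyX0 !mul1r ler_norml; lra.
Qed.

(** Every parameter no costlier than the zero vector lies in a fixed box, so a minimizer over that
    box is a global one. *)
Lemma Delta_costs_min s : is_min (Delta_costs f g d s) (Delta f g d s).
Proof.
pose F v := Delta_cost f g s (param_sos v).
have [B hB] := param_bounded s (Delta_cost_ge0 s (param_sos 0)).
pose B' := `|B|.
have [||v vB vmin] := @box_min R _ (fun=> - B') (fun=> B') F.
- by move=> i; rewrite /B'; have := normr_ge0 B; lra.
- by move=> v _; exact: continuous_Delta_cost.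
have vmin' u : F v <= F u.
  have [le|lt] := leP (F u) (F 0).
    apply: vmin => j; rewrite -ler_norml (le_trans (hB _ le j)) //; exact: ler_norm.
  apply: le_trans (ltW lt); apply: vmin => j; rewrite mxE; rewrite -ler_norml normr0.
  exact: normr_ge0.
apply: (@is_min_inf _ _ (F v)).
  by exists (param_sos v) => //; apply/param_sosP; exists v.
by move=> _ [sigma /param_sosP[u ->] <-]; exact: vmin'.
Qed.

End param.
End Delta_min.

(** * Approximation of [f_i / g_i] and of a point mass *)

(** Bernoulli's inequality gives [r ^ m (1 + m q) <= 1] with [q = 1 - r], and its square beats any
    affine function of [m]. The affine factor will be the degree of the constructed sums of
    squares. *)
Lemma geometric_decay (R : realType) (r c0 c1 : R) : 0 <= r < 1 -> 0 <= c0 -> 0 <= c1 ->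
  exists m0 : nat, forall m, (m0 <= m)%N -> r ^+ (2 * m).+1 * (c0 + c1 * m%:R) <= 1.
Proof.
move=> /andP[r0 r1] c0_ge0 c1_ge0; pose q := 1 - r.
have q0 : 0 < q by rewrite /q; lra.
have bern m : r ^+ m * (1 + m%:R * q) <= 1.
  elim: m => [|m IH]; first by rewrite expr0; lra.
  have rm : 0 <= r ^+ m by exact: exprn_ge0.
  apply: le_trans IH; rewrite exprSr -mulrA; apply: ler_wpM2l => //.
  have : 0 <= m%:R * q ^+ 2 :> R by rewrite mulr_ge0 ?sqr_ge0.
  have := sqr_ge0 q.
  rewrite -natr1 (_ : r = 1 - q); last by rewrite /q; lra.
  nra.
have /archi_boundP hb : 0 <= (c0 + c1) / q ^+ 2 by rewrite divr_ge0 ?sqr_ge0 ?addr_ge0.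
exists (Num.bound ((c0 + c1) / q ^+ 2)).+1 => m hm.
have mb : c0 + c1 <= m%:R * q ^+ 2.
  rewrite -ler_pdivrMr ?exprn_gt0 //; apply: le_trans (ltW hb) _.
  by rewrite ler_nat; lia.
have m1 : 1 <= m%:R :> R by rewrite ler1n; lia.
have rm : 0 <= r ^+ m by exact: exprn_ge0.
have rm2 : r ^+ (2 * m).+1 <= r ^+ m * r ^+ m.
  by rewrite -exprD addnn -mul2n exprS ler_piMl ?exprn_ge0 // ltW.
(* [(m q) ^ 2 = m (m q ^ 2) >= m (c0 + c1) >= c0 + c1 m]. *)
have cm : c0 + c1 * m%:R <= (1 + m%:R * q) ^+ 2 by nra.
apply: (@le_trans _ _ (r ^+ m * r ^+ m * (1 + m%:R * q) ^+ 2)).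
  by apply: ler_pM => //; [exact: exprn_ge0|rewrite addr_ge0 // mulr_ge0].
have := bern m; have : 0 <= r ^+ m * (1 + m%:R * q) by rewrite mulr_ge0 // addr_ge0 //
  mulr_ge0 // ltW.
move=> ? ?; rewrite (_ : _ * _ * _ = (r ^+ m * (1 + m%:R * q)) ^+ 2); last by ring.
exact: exprn_ile1.
Qed.

Section sos_cone.
Context {R : realType} {n : nat}.
Implicit Types (p q : mpoly n R).

Definition sos p := exists qs : seq (mpoly n R), p = \sum_(q <- qs) q ^+ 2.

Lemma sos_sqr q : sos (q ^+ 2).
Proof. by exists [:: q]; rewrite big_seq1. Qed.

Lemma sosD p q : sos p -> sos q -> sos (p + q).
Proof. by move=> [ps ->] [qs ->]; exists (ps ++ qs); rewrite big_cat. Qed.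

Lemma sos_sqrM q p : sos p -> sos (q ^+ 2 * p).
Proof.
move=> [ps ->]; exists [seq q * x | x <- ps].
by rewrite big_map mulr_sumr; apply: eq_bigr => x _; rewrite exprMn.
Qed.

Lemma sosZ (c : R) p : 0 <= c -> sos p -> sos (c *: p).
Proof.
move=> c0 /(@sos_sqrM (mpolyC n (Num.sqrt c))).
by rewrite -rmorphXn /= sqr_sqrtr // mul_mpolyC.
Qed.

(** Twice the sum equals [1 + q ^ (2m)] plus the squares [(q ^ k + q ^ (k+1)) ^ 2] for [k < m]; the
    square of [q ^ m] is kept apart for the induction. *)
Lemma sos_geometric m q : sos (\sum_(j < (2 * m).+1) q ^+ j).
Proof.
have [ps E] : exists ps : seq (mpoly n R),
    2 *: (\sum_(j < (2 * m).+1) q ^+ j) = (q ^+ m) ^+ 2 + \sum_(x <- ps) x ^+ 2.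
  elim: m => [|m [ps IH]].
    by exists [:: 1]; rewrite big_seq1 big_ord1 !expr0 expr1n scaler_nat.
  exists (q ^+ m + q ^+ m.+1 :: ps); rewrite big_cons.
  rewrite mulnS !addSn add0n !(big_ord_recr (2 * m).+2) (big_ord_recr (2 * m).+1) /=
    !scalerDr IH.
  by rewrite mul2n -addnn !exprS exprD !scaler_nat; ring.
rewrite -[X in sos X](scalerK (_ : 2 != 0 :> R)) // E.
by apply: sosZ; rewrite ?invr_ge0 //; apply: sosD; [exact: sos_sqr|exists ps].
Qed.

Lemma meval_sos_ge0 p x : sos p -> 0 <= meval x p.
Proof.
move=> [qs ->]; rewrite raddf_sum; apply: sumr_ge0 => q _ /=.
by rewrite expr2 mevalM -expr2 sqr_ge0.
Qed.

Lemma Sigma_sos d p : Sigma d p -> sos p.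
Proof. by case. Qed.

Lemma Sigma_le d d' p : (d <= d')%N -> Sigma d p -> Sigma d' p.
Proof. by move=> dd [pd ps]; split=> //; apply: leq_trans pd _; lia. Qed.

End sos_cone.

(** * Squares whose mass concentrates near a point *)

Section concentration.
Context {R : realType} {n : nat}.
Implicit Types (p : mpoly n R).

(* [psi] is proportional to [(C - p) ^ k]: a large power of the nonnegative function
   [C - p] puts almost all its mass where [C - p] exceeds [C - p(x0) - delta]. *)
Lemma concentration p (x0 : n.-tuple (measurableTypeR R)) (delta : R) :
  cube x0 -> 0 < delta ->
  exists2 psi : mpoly n R, integral_cube (psi ^+ 2) = 1 &
    integral_cube (psi ^+ 2 * p) <= meval (tnth x0) p + delta.
Proof.
(* This [C] gives [Y >= delta + 1] on the cube, so the threshold [T] is positive. *)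
move=> Kx0 delta0; pose C := norm1 p + delta + 1.
pose Y := mpolyC n C - p.
have YE x : meval (tnth x) Y = C - meval (tnth x) p by rewrite mevalB mevalC.
have Y0 x : cube x -> 0 <= meval (tnth x) Y.
  move=> Kx; rewrite YE /C; have := normr_meval_cube p Kx.
  by have := ler_norm (meval (tnth x) p); lra.
pose T := meval (tnth x0) Y - delta.
have T0 : 0 < T.
  rewrite /T YE /C; have := normr_meval_cube p Kx0.
  by have := ler_norm (meval (tnth x0) p); lra.
(* [c] is halfway between [T] and [Y(x0)]; the region [Y > c] carries mass governed by [w]. *)
pose c := T + delta / 2.
have cx0 : c < meval (tnth x0) Y by rewrite /c /T; lra.
have [w w0 hw] := integral_cube_bump Kx0 cx0.
pose V := integral_cube (1 : mpoly n R).
have V0 : 0 <= V by apply: integral_cube_ge0 => x _; rewrite meval1.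
have c0 : 0 < c by rewrite /c; lra.
(* As [T / c < 1], for large [k] the possible loss on [Y < T] is outweighed by the gain on
   [Y > c]. *)
have [k hk] : exists k, T ^+ (2 * k).+1 * V <= c ^+ (2 * k) * (delta / 2) * w.
  have rT : 0 <= T / c < 1.
    by rewrite divr_ge0 ?ltW //= ltr_pdivrMr // mul1r /c; lra.
  have K0 : 0 <= V * c / (delta / 2 * w).
    by rewrite divr_ge0 ?mulr_ge0 ?divr_ge0 // ltW.
  have [k hk] := geometric_decay rT K0 (lexx 0); exists k.
  have := hk k (leqnn k); rewrite mul0r addr0 expr_div_n.
  rewrite [leLHS](_ : _ = T ^+ (2 * k).+1 * V / (c ^+ (2 * k) * (delta / 2) * w)).
    by rewrite ler_pdivrMr ?mul1r // !mulr_gt0 ?exprn_gt0 ?divr_gt0.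
  have ck : c ^+ (2 * k) != 0 by rewrite expf_neq0 // gt_eqF.
  rewrite !exprSr; field; by rewrite ck !gt_eqF.
pose I2 := integral_cube (Y ^+ (2 * k)).
have YX x j : meval (tnth x) (Y ^+ j) = meval (tnth x) Y ^+ j by rewrite rmorphXn.
have I20 : 0 < I2.
  apply: lt_le_trans (hw (Y ^+ (2 * k)) (c ^+ (2 * k)) _ _ _).
  - by rewrite mulr_gt0 // exprn_gt0.
  - by rewrite exprn_ge0 // ltW.
  - by move=> x Kx; rewrite YX exprn_ge0 // Y0.
  - by move=> x Kx cY; rewrite YX lerXn2r ?nnegrE ?Y0 ?ltW.
(* The [Y ^ (2k)]-weighted mean of [Y] is at least [T]. Adding the constant [T ^ (2k+1)] makes the
   integrand nonnegative also where [Y < T], so that the bump estimate applies to it. *)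
have IT : 0 <= integral_cube (Y ^+ (2 * k) * (Y - mpolyC n T)).
  pose q := Y ^+ (2 * k) * (Y - mpolyC n T) + mpolyC n (T ^+ (2 * k).+1).
  have qE x : meval (tnth x) q =
      meval (tnth x) Y ^+ (2 * k) * (meval (tnth x) Y - T) + T ^+ (2 * k).+1.
    by rewrite mevalD mevalM mevalB !mevalC YX.
  have := hw q (c ^+ (2 * k) * (delta / 2)); rewrite /q integral_cubeD.
  have -> : mpolyC n (T ^+ (2 * k).+1) = T ^+ (2 * k).+1 *: 1.
    by rewrite -mul_mpolyC mulr1.
  rewrite integral_cubeZ -/V => h.
  suff : c ^+ (2 * k) * (delta / 2) * w <=
    integral_cube (Y ^+ (2 * k) * (Y - mpolyC n T)) + T ^+ (2 * k).+1 * V by lra.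
  have Tk : 0 <= T ^+ (2 * k).+1 by rewrite exprn_ge0 // ltW.
  apply: h => [|x Kx|x Kx cY].
  - by rewrite mulr_ge0 ?divr_ge0 ?exprn_ge0 ?ltW.
  - rewrite -mul_mpolyC mulr1 qE; have yx := Y0 x Kx; move: (meval _ Y) yx => y y0.
    have [le|lt] := leP T y.
      by rewrite addr_ge0 // mulr_ge0 ?exprn_ge0 // subr_ge0.
    have : y ^+ (2 * k) * (T - y) <= T ^+ (2 * k) * T.
      apply: ler_pM; rewrite ?exprn_ge0 //; [lra| |lra].
      by rewrite lerXn2r ?nnegrE //; exact: ltW.
    by rewrite exprSr; lra.
  - rewrite -mul_mpolyC mulr1 qE; have yx := Y0 x Kx; move: (meval _ Y) cY yx => y cY y0.
    rewrite -[leLHS]addr0; apply: lerD => //; apply: ler_pM.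
    + by rewrite exprn_ge0 // ltW.
    + by lra.
    + by rewrite lerXn2r ?nnegrE //; exact: ltW.
    + by move: cY; rewrite /c; lra.
exists ((Num.sqrt I2)^-1 *: Y ^+ k).
  rewrite exprZn -exprM mulnC integral_cubeZ exprVn sqr_sqrtr ?(ltW I20) //.
  by rewrite -/I2 mulVf // gt_eqF.
rewrite exprZn -exprM mulnC -scalerAl integral_cubeZ exprVn sqr_sqrtr ?(ltW I20) //.
rewrite ler_pdivrMl //.
have E (a b : R) (q : mpoly n R) :
    q * (mpolyC n a - p - mpolyC n b) = (a - b) *: q - q * p.
  by rewrite -mul_mpolyC [mpolyC n (a - b)]mpolyCB; ring.
move: IT; rewrite E integral_cubeB integral_cubeZ -/I2.
have -> : C - T = meval (tnth x0) p + delta by rewrite /T YE; lra.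
by rewrite subr_ge0 [I2 * _]mulrC.
Qed.

End concentration.

Section distance_bounds.
Variable R : realType.
Implicit Types a b c d e : R.

Lemma itv_dist a b c : 0 <= a <= c -> 0 <= b <= c -> `|a - b| <= c.
Proof. by rewrite ler_norml; lra. Qed.

Lemma dist_lower a b c d : a <= b -> `|c - b| <= d -> a - d <= c.
Proof. by rewrite ler_norml; lra. Qed.

Lemma dist_upper a b c d : `|a - c| <= d -> `|b - c| <= d -> a <= b + 2 * d.
Proof. by rewrite !ler_norml; lra. Qed.

Lemma dist_chain a b c d e : a - d <= e <= b + 2 * d -> b <= c + d -> `|c - a| <= d ->
  `|e - a| <= 4 * d.
Proof. by rewrite !ler_norml => *; apply/andP; split; lra. Qed.

Lemma dist_transfer a b c d e (u : R) : a - b <= c -> `|a - d| <= e -> b <= u -> d - e -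
  u <= c.
Proof. by rewrite ler_norml; lra. Qed.

End distance_bounds.

(** * Truncated geometric series for [1 / g_i] and the two estimates *)

Section approximation.
Context {R : realType} {n : nat}.
Variables (M : nat) (f g : 'I_M.+1 -> mpoly n R).
Hypothesis g_gt0 : forall i x, cube x -> 0 < meval (tnth x) (g i).
Variable A : R.
Hypothesis A1 : 1 <= A.
Hypothesis gA : forall i x, cube x -> A^-1 <= meval (tnth x) (g i) <= A.
Implicit Types (x : n.-tuple (measurableTypeR R)) (i : 'I_M.+1) (m : nat).

Let A0 : 0 < A. Proof. exact: lt_le_trans A1. Qed.

(** [1 - residue i] is [g i / A], so the geometric series in [residue i] expands [A / g i]. *)
Definition residue i : mpoly n R := 1 - A^-1 *: g i.

Definition approx_inv m i : mpoly n R :=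
  A^-1 *: \sum_(j < (2 * m).+1) residue i ^+ j.

(** The largest value of a residue compatible with [g i >= A^-1]. *)
Definition rate : R := 1 - A^-1 * A^-1.

Lemma rate_itv : 0 <= rate < 1.
Proof.
have i0 : 0 < A^-1 by rewrite invr_gt0.
have i1 : A^-1 <= 1 by rewrite invf_le1.
by rewrite /rate; nra.
Qed.

Let rate_ge0 k : 0 <= rate ^+ k.
Proof. by rewrite exprn_ge0 //; case/andP: rate_itv. Qed.

Lemma mul_approx_inv m i : g i * approx_inv m i = 1 - residue i ^+ (2 * m).+1.
Proof.
have gE : g i = A *: (1 - residue i).
  by rewrite /residue opprB addrC subrK scalerA mulfV ?scale1r // gt_eqF.
rewrite /approx_inv {1}gE -scalerAl -scalerAr scalerA mulfV ?gt_eqF // scale1r.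
by rewrite -[RHS]opprB subrX1 -mulNr (opprB (residue i)).
Qed.

Lemma residue_itv x i : cube x -> 0 <= meval (tnth x) (residue i) <= rate.
Proof.
move=> Kx; have /andP[g1 g2] := gA i Kx.
have i0 : 0 < A^-1 by rewrite invr_gt0.
rewrite /residue mevalB meval1 mevalZ /rate lerD2l lerN2 ler_pM2l // g1 andbT subr_ge0.
by rewrite ler_pdivrMl // mulr1.
Qed.

Lemma residueX_itv m x i : cube x ->
  0 <= meval (tnth x) (residue i ^+ m) <= rate ^+ m.
Proof.
move=> /residue_itv-/(_ i)/andP[r0 r1]; rewrite rmorphXn exprn_ge0 //=.
by rewrite lerXn2r // nnegrE // (le_trans r0).
Qed.

Lemma sos_approx_inv m i : sos (approx_inv m i).
Proof. by apply: sosZ; rewrite ?invr_ge0 ?ltW //; exact: sos_geometric. Qed.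

Lemma meval_mul_approx_inv m x i : meval (tnth x) (f i * approx_inv m i) * meval (tnth x)
  (g i) =
  meval (tnth x) (f i) * (1 - meval (tnth x) (residue i ^+ (2 * m).+1)).
Proof.
by rewrite mevalM -mulrA [meval _ (approx_inv _ _) * _]mulrC -mevalM mul_approx_inv
  mevalB meval1.
Qed.

Definition ratio_approx m : mpoly n R := \sum_i f i * approx_inv m i.

Definition norm_sum : R := A * \sum_i norm1 (f i).

Let norm_sum_ge0 : 0 <= norm_sum.
Proof. by rewrite mulr_ge0 ?(ltW A0) //; apply: sumr_ge0 => i _; exact: norm1_ge0. Qed.

(** The difference is [f_i] times a power of the residue. The factor [A g_i >= 1] is inserted so
    that the bound, once integrated against [sigma_i], involves only the mass of [g_i sigma_i]. *)
Lemma approx_inv_error m x i : cube x ->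
  `|meval (tnth x) (f i) - meval (tnth x) (f i * approx_inv m i) * meval (tnth x) (g i)|
   <= rate ^+ (2 * m).+1 * (A * norm1 (f i)) * meval (tnth x) (g i).
Proof.
move=> Kx; rewrite meval_mul_approx_inv.
rewrite (_ : _ - _ = meval (tnth x) (f i) * meval (tnth x) (residue i ^+ (2 * m).+1));
  last by ring.
have /andP[r0 r1] := residueX_itv (2 * m).+1 i Kx.
have /andP[g1 g2] := gA i Kx.
have Ag : 1 <= A * meval (tnth x) (g i) by rewrite -ler_pdivrMl // mulr1.
apply: (@le_trans _ _ (norm1 (f i) * rate ^+ (2 * m).+1)).
  by rewrite normrM (ger0_norm r0); apply: ler_pM => //; exact: normr_meval_cube.
rewrite [leRHS](_ : _ = norm1 (f i) * rate ^+ (2 * m).+1 * (A * meval (tnth x) (g i)));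
  last by ring.
by rewrite ler_peMr // mulr_ge0 // norm1_ge0.
Qed.

Lemma ratio_approx_error m x : cube x ->
  `|meval (tnth x) (ratio_approx m) - \sum_i meval (tnth x) (f i) / meval (tnth x) (g i)|
   <= rate ^+ (2 * m).+1 * norm_sum.
Proof.
move=> Kx; rewrite /ratio_approx raddf_sum -sumrB /norm_sum mulrA mulr_sumr.
apply: le_trans (ler_norm_sum _ _ _) _; apply: ler_sum => i _ /=.
have gx := g_gt0 i Kx.
rewrite -(ler_pM2r gx) -[X in _ * X <= _](gtr0_norm gx) -normrM mulrBl divfK ?gt_eqF //.
by rewrite distrC -(mulrA _ A); exact: approx_inv_error.
Qed.

Lemma approx_accuracy (delta : R) : 0 < delta ->
  exists m0, forall m, (m0 <= m)%N -> rate ^+ (2 * m).+1 * norm_sum <= delta.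
Proof.
move=> d0; have c0 : 0 <= norm_sum / delta by rewrite divr_ge0 // ltW.
have [m0 hm0] := geometric_decay rate_itv c0 (lexx 0).
by exists m0 => m /hm0; rewrite mul0r addr0 mulrA ler_pdivrMr // mul1r.
Qed.

Lemma normr_integral_moments (p q : mpoly n R) s (e : R) (h : mpoly n R) :
  (msize h <= s.+1)%N ->
  (forall a : multinom n, (mdeg a <= s)%N ->
    `|integral_cube (mpolyX R a * p) - integral_cube (mpolyX R a * q)| <= e) ->
  `|integral_cube (h * p) - integral_cube (h * q)| <= norm1 h * e.
Proof.
move=> hs gap; rewrite [h in integral_cube (h * p)]mpolyE [h in integral_cube (h *
  q)]mpolyE.
rewrite !mulr_suml !integral_cube_sum -sumrB.
apply: le_trans (ler_norm_sum _ _ _) _.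
rewrite big_seq [leRHS]big_seq; apply: ler_sum => a ah.
rewrite -!scalerAl !integral_cubeZ -mulrBr normrM ler_wpM2l // gap //.
by rewrite -ltnS (leq_trans _ hs) //; exact: msize_mdeg_lt.
Qed.

(** The approximants [h i] depend on [delta] alone, so once [s] reaches their degrees the moment
    constraints apply to them with constants independent of [s] and [d]. *)
Lemma objective_lower_bound (delta : R) : 0 < delta ->
  exists L : R, exists s0 : nat, 0 <= L /\ forall s d (e : R) sigma, (s0 <= s)%N ->
    0 <= e <= 1 -> feasible g s d e sigma ->
    rho f g - L * e - delta <= objective f sigma.
Proof.
(* The total loss is [2 dl] on the lower bound of [\sum_i h i], against a mass at most 2, and [3 dl]
   for each of the [M + 1] terms, of mass at most 3. *)
move=> delta0; pose c : R := 2 + 3 * M.+1%:R.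
have c0 : 0 < c by rewrite /c ltr_pwDl // mulr_ge0.
pose dl := delta / c; have dl0 : 0 < dl by rewrite divr_gt0.
have [m /(_ m (leqnn m)) hm] := approx_accuracy dl0.
pose h i := f i * approx_inv m i.
pose L := \sum_i norm1 (h i); have L0 : 0 <= L by apply: sumr_ge0 => i _; exact: norm1_ge0.
(* [|rho|] pays for the mass gap and [L] for the moment gaps. *)
exists (`|rho f g| + L), (\max_i msize (h i))%N; split; first by rewrite addr_ge0.
move=> s d e sigma s0s /andP[e0 e1] [sS gap mass].
have hs i : (msize (h i) <= s.+1)%N.
  by apply: leq_trans (leqW s0s); exact: (leq_bigmax i).
have sx i x : 0 <= meval (tnth x) (sigma i) by apply: meval_sos_ge0;
  exact: Sigma_sos (sS i).
have gap' i (a : multinom n) : (mdeg a <= s)%N ->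
    `|integral_cube (mpolyX R a * (g i * sigma i)) -
      integral_cube (mpolyX R a * (g ord0 * sigma ord0))| <= e.
  move=> sa; have [->|i0] := eqVneq i ord0; first by rewrite subrr normr0.
  by rewrite !mulrA; exact: gap.
have mass_le i : integral_cube (g i * sigma i) <= 3.
  have := gap' i (@mnm0 n); rewrite mdeg0 => /(_ isT).
  by move: mass; rewrite /mass_gap mpolyX0 !mul1r !ler_norml; lra.
have rho_le x : cube x -> rho f g <= \sum_i meval (tnth x) (f i) / meval (tnth x) (g i).
  by move=> Kx; apply: (ratio_sums_min f g_gt0).2; exists x.
have term i : integral_cube (f i * sigma i) >=
    integral_cube (h i * (g ord0 * sigma ord0)) - norm1 (h i) * e - 3 * dl.
  have t1 : integral_cube (h i * (g i * sigma i) - dl *: (g i * sigma i)) <=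
      integral_cube (f i * sigma i).
    apply: le_integral_cube => x Kx; rewrite mevalB mevalZ !mevalM mulrA mulrA -mulrBl.
    apply: ler_wpM2r => //; have := approx_inv_error m i Kx.
    have gx := g_gt0 i Kx; rewrite ler_norml => /andP[+ _];
      rewrite -[f i * approx_inv m i]/(h i).
    have : rate ^+ (2 * m).+1 * (A * norm1 (f i)) <= dl.
      apply: le_trans hm; apply: ler_wpM2l => //; rewrite /norm_sum; apply: ler_wpM2l;
        first exact: ltW.
      rewrite (bigD1 i) //= lerDl; apply: sumr_ge0 => j _; exact: norm1_ge0.
    have -> : meval (tnth x) (h i) = meval (tnth x) (f i) * meval (tnth x) (approx_inv m
      i) := mevalM _ _ _.
    move=> /(ler_wpM2r (ltW gx)). lra.
  move: t1; rewrite integral_cubeB integral_cubeZ => t1.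
  rewrite [3 * dl]mulrC.
  exact: dist_transfer t1 (normr_integral_moments (hs i) (gap' i)) (ler_wpM2l (ltW dl0)
    (mass_le i)).
pose P := ratio_approx m.
have PE : integral_cube (P * (g ord0 * sigma ord0)) =
    \sum_i integral_cube (h i * (g ord0 * sigma ord0)).
  by rewrite /P /ratio_approx mulr_suml integral_cube_sum.
have Plow : integral_cube (P * (g ord0 * sigma ord0)) >=
    (rho f g - dl) * integral_cube (g ord0 * sigma ord0).
  rewrite -integral_cubeZ; apply: le_integral_cube => x Kx; rewrite mevalZ [leRHS]mevalM.
  apply: ler_wpM2r; first by rewrite mevalM mulr_ge0 // ltW // g_gt0.
  have := ratio_approx_error m Kx; have := rho_le x Kx; rewrite ler_norml -/P; lra.
have obj : objective f sigma >= integral_cube (P * (g ord0 * sigma ord0)) - L * e -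
  M.+1%:R * (3 * dl).
  rewrite PE /objective /L mulr_suml -[M.+1 in X in _ - X <= _]card_ord mulr_natl
    -sumr_const.
  by rewrite -!sumrB; apply: ler_sum => i _; exact: term.
have rhoe : rho f g * integral_cube (g ord0 * sigma ord0) >= rho f g - `|rho f g| * e.
  have : `|rho f g * (integral_cube (g ord0 * sigma ord0) - 1)| <= `|rho f g| * e.
    by rewrite normrM ler_wpM2l.
  by rewrite ler_norml; lra.
have dle : dl * integral_cube (g ord0 * sigma ord0) <= dl * 2.
  by apply: ler_wpM2l; [exact: ltW|move: mass; rewrite /mass_gap ler_norml; lra].
have dE : delta = 2 * dl + M.+1%:R * (3 * dl).
  by rewrite (_ : delta = c * dl) /c ?/dl; [lra|rewrite mulrC divfK // gt_eqF].
lra.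
Qed.

(** [psi] is fixed before [m], so the degree is affine in [m] while the gaps decay geometrically.
    Having [s < D] makes [1 / sqrt D] tend to 0 with [s]. *)
Lemma good_sigma (delta : R) (s : nat) : 0 < delta ->
  exists D : nat, exists sigma, [/\ (s < D)%N, forall i, Sigma D (sigma i),
    forall a i, moment_gap g sigma a i <= 1 / Num.sqrt D%:R,
    mass_gap g sigma <= 1 / Num.sqrt D%:R &
    `|objective f sigma - rho f g| <= delta].
Proof.
(* One quarter is for concentration, one for the approximation at the minimizer, and two for passing
   from [m0] to [m]. *)
move=> delta0; have dl0 : 0 < delta / 4 by lra.
set dl := delta / 4 in dl0.
have [m0 hm0] := approx_accuracy dl0.
have [[x0 Kx0 x0E] rho_min] := ratio_sums_min f g_gt0.
have rho_le x : cube x -> rho f g <= \sum_i meval (tnth x) (f i) / meval (tnth x) (g i).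
  by move=> Kx; apply: rho_min; exists x.
have [psi psi1 psiP] := concentration (ratio_approx m0) Kx0 dl0.
pose e := msize psi; pose b := (\max_i msize (g i))%N.
have c0 : 0 <= (e + s).+1%:R :> R by [].
have [m1 hm1] := geometric_decay rate_itv c0 (ler0n R b).
(* [(e + s).+1] absorbs the degree of [psi] and exceeds [s], and [b * m] is half the degree bound of
   [approx_inv m]. The choice of [m1] gives [rate ^ (2m+1) * D <= 1], stronger than the bound by
   [1 / sqrt D]. *)
pose m := maxn m0 m1; pose D := ((e + s).+1 + b * m)%N.
have D1 : (0 < D)%N by [].
have rD : rate ^+ (2 * m).+1 <= 1 / Num.sqrt D%:R.
  have sD : 0 < Num.sqrt (D%:R : R) by rewrite sqrtr_gt0 ltr0n.
  rewrite ler_pdivlMr //; apply: le_trans (hm1 m (leq_maxr _ _)).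
  apply: ler_wpM2l => //; rewrite -natrM -natrD -/D -[leRHS]sqr_sqrtr //.
  by rewrite expr2 ler_peMr // ?sqrtr_ge0 // -[leLHS]sqrtr1 ler_wsqrtr // ler1n.
pose sigma i := psi ^+ 2 * approx_inv m i.
have psi0 x : 0 <= meval (tnth x) (psi ^+ 2) by apply: meval_sos_ge0; exact: sos_sqr.
have gs i : g i * sigma i = psi ^+ 2 * (1 - residue i ^+ (2 * m).+1).
  by rewrite /sigma mulrCA mul_approx_inv.
exists D, sigma; split.
- by rewrite /D; lia.
- move=> i; split; last by have := sos_sqrM psi (sos_approx_inv m i).
  have gb : (msize (g i) <= b.+1)%N by apply: leqW; exact: (leq_bigmax i).
  have rb : (msize (residue i) <= b.+1)%N.
    apply: leq_trans (mmeasureD_le _ _ _) _; rewrite mmeasure1 mmeasureN geq_max /=.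
    exact: leq_trans (msizeZ_le _ _) gb.
  have ub : (msize (approx_inv m i) <= (2 * m * b).+1)%N.
    apply: leq_trans (msizeZ_le _ _) _; apply: msize_sum_deg => j _.
    apply: leq_trans (msizeX_deg _ rb) _; rewrite ltnS leq_mul2r.
    by rewrite -ltnS ltn_ord orbT.
  have pb : (msize (psi ^+ 2) <= (2 * e).+1)%N by apply: msizeX_deg.
  apply: leq_trans (msizeM_deg pb ub) _; rewrite /D; nia.
- move=> a i; apply: le_trans rD; rewrite /moment_gap -!mulrA !gs -integral_cubeB.
  have -> (X p q r : mpoly n R) : X * (p * (1 - q)) - X * (p * (1 - r)) = p * (X * (r -
    q)) by ring.
  rewrite -[leRHS]mulr1 -psi1 -integral_cubeZ; apply: normr_integral_cube => x Kx.
  rewrite mevalM normrM (ger0_norm (psi0 x)) mevalZ mulrC; apply: ler_wpM2r => //.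
  have ri := residueX_itv (2 * m).+1 i Kx.
  have r0 := residueX_itv (2 * m).+1 ord0 Kx.
  rewrite mevalM mevalB normrM -[leRHS]mul1r; apply: ler_pM => //.
    exact: normr_monomial_cube.
  exact: itv_dist r0 ri.
- apply: le_trans rD; rewrite /mass_gap gs -psi1 -integral_cubeB.
  have -> (p q : mpoly n R) : p * (1 - q) - p = p * - q by ring.
  rewrite -[leRHS]mulr1 -psi1 -integral_cubeZ; apply: normr_integral_cube => x Kx.
  rewrite mevalM normrM (ger0_norm (psi0 x)) mevalZ mulrC; apply: ler_wpM2r => //.
  have /andP[r0 r1] := residueX_itv (2 * m).+1 ord0 Kx.
  by rewrite mevalN normrN ger0_norm.
have -> : objective f sigma = integral_cube (psi ^+ 2 * ratio_approx m).
  rewrite /objective /ratio_approx mulr_sumr integral_cube_sum.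
  by apply: eq_bigr => i _; rewrite /sigma mulrCA.
have hm k x : (m0 <= k)%N -> cube x -> `|meval (tnth x) (ratio_approx k) -
    \sum_i meval (tnth x) (f i) / meval (tnth x) (g i)| <= dl.
  by move=> k0 Kx; exact: le_trans (ratio_approx_error k Kx) (hm0 k k0).
have mm : (m0 <= m)%N by exact: leq_maxl.
(* [psi] concentrates for the approximant of index [m0]; both approximants are within [dl] of the
   ratio sum. *)
have upper : integral_cube (psi ^+ 2 * ratio_approx m) <=
    integral_cube (psi ^+ 2 * ratio_approx m0 + (2 * dl) *: psi ^+ 2).
  apply: le_integral_cube => x Kx; rewrite mevalD mevalZ ![meval _ (psi ^+ 2 * _)]mevalM.
  rewrite [2 * dl * _]mulrC -mulrDr; apply: ler_wpM2l => //.
  exact: dist_upper (hm _ x mm Kx) (hm _ x (leqnn _) Kx).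
have lower : integral_cube ((rho f g - dl) *: psi ^+ 2) <=
    integral_cube (psi ^+ 2 * ratio_approx m).
  apply: le_integral_cube => x Kx; rewrite mevalZ [leRHS]mevalM mulrC;
    apply: ler_wpM2l => //.
  exact: dist_lower (rho_le x Kx) (hm _ x mm Kx).
move: upper lower; rewrite integral_cubeD !integral_cubeZ psi1 !mulr1 => upper lower.
have -> : delta = 4 * dl by rewrite /dl mulrC divfK.
apply: (dist_chain _ psiP); first by rewrite lower.
by rewrite -x0E; exact: hm.
Qed.

End approximation.

(** * Passage to the limit *)

Lemma invr_sqrtn_cvg0 (R : realType) : (Num.sqrt s.+1%:R)^-1 @[s --> \oo] --> (0 : R).
Proof.
apply/cvgrPdist_le => e e0; near=> s.
have e20 : 0 < e ^- 2 by rewrite invr_gt0 exprn_gt0.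
have s0 : 0 < Num.sqrt (s.+1%:R : R) by rewrite sqrtr_gt0 ltr0n.
rewrite sub0r normrN gtr0_norm ?invr_gt0 // -[e]invrK lef_pV2 ?posrE ?invr_gt0 //.
rewrite -[leLHS]gtr0_norm ?invr_gt0 // -sqrtr_sqr ler_wsqrtr // exprVn.
apply: le_trans (ltW (archi_boundP (ltW e20))) _; rewrite ler_nat; apply: leqW.
near: s; exact: nbhs_infty_ge.
Unshelve. all: by end_near. Qed.

Theorem theorem6 (R : realType) (n M : nat) (f g : 'I_M.+1 -> mpoly n R)
    (g_gt0 : forall i x, cube x -> 0 < meval (tnth x) (g i)) :
  [/\ is_min (ratio_sums f g) (rho f g),
      forall d s : nat, is_min (Delta_costs f g d s) (Delta f g d s) &
      exists d0 : nat -> nat,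
        [/\ forall s, (0 < d0 s)%N,
            Delta f g (d0 s) s @[s --> \oo] --> (0 : R) &
            forall d : nat -> nat, (forall s, (d0 s <= d s)%N) ->
              rho_relax f g s (d s) (1 / Num.sqrt (d0 s)%:R) @[s --> \oo]
                --> (rho f g)%:E]].
Proof.
split; [exact: ratio_sums_min|by move=> d s; exact: Delta_costs_min|].
have [A A1 gA] := two_sided_bound g_gt0.
(* [eta s] is the accuracy requested from [good_sigma] and, since [s < d0 s], also bounds
   [1 / sqrt (d0 s)]. *)
pose eta (s : nat) : R := (Num.sqrt s.+1%:R)^-1.
have eta0 s : 0 < eta s by rewrite invr_gt0 sqrtr_gt0 ltr0n.
have [d0 hd0] := choice (fun s => good_sigma f g_gt0 A1 gA s (eta0 s)).
have [sg hsg] := choice hd0.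
have dpos s : (0 < d0 s)%N by have [sd _ _ _ _] := hsg s; exact: leq_trans sd.
have gap_eta s : 0 <= 1 / Num.sqrt ((d0 s)%:R : R) <= eta s.
  have [sd _ _ _ _] := hsg s.
  rewrite mul1r invr_ge0 sqrtr_ge0 /= /eta lef_pV2 ?posrE ?sqrtr_gt0 ?ltr0n //.
  by rewrite ler_wsqrtr // ler_nat.
have eta1 s : eta s <= 1 by rewrite /eta invf_le1 ?sqrtr_gt0 ?ltr0n // -[leLHS]sqrtr1
  ler_wsqrtr // ler1n.
have eta_small (e : R) : 0 < e -> \forall s \near \oo, eta s <= e.
  move/cvgrPdist_le : (@invr_sqrtn_cvg0 R) => /[apply]; apply: filterS => s.
  by rewrite sub0r normrN gtr0_norm.
exists d0; split => // [|d d0d].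
  apply: (@squeeze_cvgr _ _ _ _ (fun=> 0) eta); [|exact: cvg_cst|exact: invr_sqrtn_cvg0].
  near=> s; have [_ hS hgap hmass hobj] := hsg s.
  have [[sigma _ <-] lb] := Delta_costs_min f (d0 s) g_gt0 s.
  rewrite Delta_cost_ge0 /=.
  apply: le_trans (lb _ _) _; first by exists (sg s).
  have /andP[_ ge] := gap_eta s.
  apply/Delta_costP; first exact: ltW.
  split; [move=> a i _ _; exact: le_trans (hgap a i) ge|exact: le_trans hmass ge|exact:
    hobj].
(* [sg s] stays feasible for [d s >= d0 s] because [Sigma] grows with the degree. *)
have upper s : (rho_relax f g s (d s) (1 / Num.sqrt (d0 s)%:R) <= (rho f g + eta s)%:E)%E.
  have [_ hS hgap hmass hobj] := hsg s.
  apply: ge_ereal_inf; exists (objective f (sg s))%:E.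
    by exists (sg s) => //; split => // i; exact: Sigma_le (d0d s) (hS i).
  by rewrite lee_fin; move: hobj; rewrite ler_norml; lra.
have lower (e : R) : 0 < e -> \forall s \near \oo,
    ((rho f g - e)%:E <= rho_relax f g s (d s) (1 / Num.sqrt (d0 s)%:R))%E.
  move=> e0; have e20 : 0 < e / 2 by rewrite divr_gt0.
  have [L [s0 [L0 hL]]] := objective_lower_bound f g_gt0 A1 gA e20.
  (* [L + 1] keeps the denominator positive when [L = 0]. *)
  have Le : 0 < e / 2 / (L + 1) by rewrite divr_gt0 // ltr_pwDr.
  near=> s; apply/ereal_infP => _ [sigma hsigma <-]; rewrite lee_fin.
  have /andP[ge0 ge1] := gap_eta s.
  have etaL : eta s <= e / 2 / (L + 1).
    by near: s; exact: eta_small.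
  apply: le_trans (hL s (d s) _ sigma _ _ hsigma); last 2 first.
  - by near: s; exact: nbhs_infty_ge.
  - by rewrite ge0 (le_trans ge1).
  have : L * (1 / Num.sqrt (d0 s)%:R) <= e / 2.
    apply: (@le_trans _ _ ((L + 1) * (e / 2 / (L + 1))));
      last by rewrite mulrC divfK // gt_eqF // ltr_pwDr.
    by apply: ler_pM => //; [lra|exact: le_trans etaL].
  lra.
(* The upper bound excludes the value [+oo], and the eventual lower bound excludes [-oo]. *)
apply/fine_cvgP; split.
  near=> s; rewrite fin_numElt (le_lt_trans (upper s) (ltry _)) andbT.
  by apply: (lt_le_trans (ltNyr (rho f g - 1))); near: s; exact: lower.
apply/cvgrPdist_le => e e0; near=> s.
have : ((rho f g - e)%:E <= rho_relax f g s (d s) (1 / Num.sqrt (d0 s)%:R))%E.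
  by near: s; exact: lower.
have etae : eta s <= e.
  by near: s; exact: eta_small.
have := upper s; rewrite /=; case: (rho_relax _ _ _ _ _) => [r| |] //.
by rewrite !lee_fin /= ler_norml => *; apply/andP; split; lra.
Unshelve. all: by end_near. Qed.
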